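(* Let $A\in R(\Omega)$ and let $x'\in\Omega$. Then the involution kernel of $A$ based at $x'$ exists, i.e. the series $$W(y|x)=\sum_{n=1}^{\infty}\big[A(y_n,\dots,y_1,x_1,x_2,\dots)-A(y_n,\dots,y_1,x'_1,x'_2,\dots)\big]$$ converges for every $(y|x)\in\hat\Omega$, if and only if $A$ has Walters regularity, i.e. $A\in\Xi(\Omega)$.
   Context: $\mathbb N=\{1,2,3,\dots\}$, $\Omega=\{0,1\}^{\mathbb N}$ with metric $d(x,y)=2^{-j}$, $j$ the first index with $x_j\neq y_j$ (and $d(x,x)=0$), and $\sigma(x_1,x_2,\dots)=(x_2,x_3,\dots)$. $\Omega^-$ is a copy of $\Omega$ whose points are written $y=(y_1,y_2,\dots)$; $\hat\Omega=\Omega^-\times\Omega$, with points $(y|x)=(\dots,y_2,y_1|x_1,x_2,\dots)$. The Walters family $R(\Omega)$ is the set of continuous functions $A:\Omega\to\mathbb R$ for which there are convergent real sequences $(a_n),(b_n),(c_n),(d_n)$ such that for all $n\in\mathbb N$ and all $z\in\Omega$: $A(0^{n+1}1z)=a_{n+1}$, $A(01^n0z)=b_n$, $A(1^{n+1}0z)=c_{n+1}$, $A(10^n1z)=d_n$. $\Xi(\Omega)$ (potentials with Walters regularity) is the set of continuous $A:\Omega\to\mathbb R$ such that for every $\epsilon>0$ there is $\delta>0$ such that for all $n\in\mathbb N$, all $x\in\Omega$ and all $y\in B(x,n,\delta)$, $\left|\sum_{j=0}^{n-1}A(\sigma^j x)-\sum_{j=0}^{n-1}A(\sigma^j y)\right|<\epsilon$.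 Here $B(x,n,\delta)=\{y\in\Omega: d(\sigma^jx,\sigma^jy)<\delta \text{ for } 0\le j\le n-1\}$. *)

(* Defs.v *)
From HB Require Import structures.
From mathcomp Require Import all_boot all_order all_algebra.
From mathcomp Require Import mathcomp_extra boolp classical_sets functions reals.
From mathcomp Require Import topology normedtype sequences.

Set Implicit Arguments.
Unset Strict Implicit.
Unset Printing Implicit Defensive.

Import Order.TTheory GRing.Theory Num.Theory.
Import numFieldNormedType.Exports.

Local Open Scope classical_set_scope.
Local Open Scope ring_scope.

(* The letters 0 and 1 are [false] and [true]. Points are indexed from 0, so
   the coordinate x_i (i >= 1) of the usual notation is [x i.-1].
   The parameter [R] is the type of real numbers in which distances live. *)
Definition Omega (R : realType) : Type := nat -> bool.

HB.instance Definition _ (R : realType) :=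
  Pointed.copy (Omega R) (nat -> bool).

(* [ex_minn xy] is the 0-based index of the first disagreement, whence the
   successor in the exponent. *)
Definition Omega_dist (R : realType) (x y : Omega R) : R :=
  if pselect (exists i, x i != y i) is left xy then 2^-1 ^+ (ex_minn xy).+1
  else 0.

Lemma Omega_distxx (R : realType) (x : Omega R) : Omega_dist x x = 0.
Proof.
by rewrite /Omega_dist; case: pselect => // xx; have [i] := xx; rewrite eqxx.
Qed.

Lemma Omega_dist_positivity (R : realType) (x y : Omega R) :
  Omega_dist x y = 0 -> x = y.
Proof.
rewrite /Omega_dist; case: pselect => [xy /eqP|xy _].
  by rewrite expf_eq0 /= invr_eq0 pnatr_eq0.
by apply/funext => i; apply/eqP; apply: contra_notT xy => ?; exists i.
Qed.

Lemma Omega_dist_sym (R : realType) (x y : Omega R) :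
  Omega_dist x y = Omega_dist y x.
Proof.
rewrite /Omega_dist; case: pselect => [xy|xy]; case: pselect => [yx|yx] //.
- by congr (_ ^+ _.+1); apply: eq_ex_minn => i; rewrite eq_sym.
- by have [i xyi] := xy; case: (yx); exists i; rewrite eq_sym.
- by have [i yxi] := yx; case: (xy); exists i; rewrite eq_sym.
Qed.

Lemma Omega_dist_ge0 (R : realType) (x y : Omega R) : 0 <= Omega_dist x y.
Proof.
by rewrite /Omega_dist; case: pselect => // ?; rewrite exprn_ge0 // invr_ge0.
Qed.

Lemma Omega_dist_ge (R : realType) (x y : Omega R) (i : nat) :
  x i != y i -> 2^-1 ^+ i.+1 <= Omega_dist x y.
Proof.
move=> xyi; rewrite /Omega_dist; case: pselect => [xy|[]]; last by exists i.
case: ex_minnP => m _ /(_ i xyi) mi.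
by rewrite ler_wiXn2l // ?invr_ge0 // invf_le1 // ler1n.
Qed.

Lemma Omega_dist_triangle (R : realType) (y x z : Omega R) :
  Omega_dist x z <= Omega_dist x y + Omega_dist y z.
Proof.
rewrite {1}/Omega_dist; case: pselect => [xz|_]; last first.
  by rewrite addr_ge0 // Omega_dist_ge0.
case: ex_minnP => m xzm _; have [xym|xym] := eqVneq (x m) (y m).
  by rewrite ler_wpDl ?Omega_dist_ge0 // Omega_dist_ge // -xym.
by rewrite ler_wpDr ?Omega_dist_ge0 // Omega_dist_ge.
Qed.

HB.instance Definition _ (R : realType) :=
  isMetric.Build R (Omega R) (@Omega_distxx R) (@Omega_dist_positivity R)
    (@Omega_dist_sym R) (@Omega_dist_triangle R).

Definition Omega_shift (R : realType) (x : Omega R) : Omega R :=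
  fun i => x i.+1.

Definition prepend (R : realType) (w : seq bool) (z : Omega R) : Omega R :=
  fun i => if (i < size w)%N then nth false w i else z (i - size w)%N.

Definition Walters_family (R : realType) : set (Omega R -> R) :=
  [set A | continuous A /\
    exists a b c d : R^nat,
      [/\ cvgn a, cvgn b, cvgn c & cvgn d] /\
      forall (n : nat) (z : Omega R), (0 < n)%N ->
        [/\ A (prepend (nseq n.+1 false ++ [:: true]) z) = a n.+1,
            A (prepend ([:: false] ++ nseq n true ++ [:: false]) z) = b n,
            A (prepend (nseq n.+1 true ++ [:: false]) z) = c n.+1 &
            A (prepend ([:: true] ++ nseq n false ++ [:: true]) z) = d n]].

Definition Bowen_ball (R : realType) (x : Omega R) (n : nat) (delta : R) :
    set (Omega R) :=
  [set y | forall j, (j < n)%N ->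
    mdist (iter j (@Omega_shift R) x) (iter j (@Omega_shift R) y) < delta].

Definition Birkhoff_sum (R : realType) (A : Omega R -> R) (n : nat)
    (x : Omega R) : R :=
  \sum_(0 <= j < n) A (iter j (@Omega_shift R) x).

Definition Walters_regular (R : realType) : set (Omega R -> R) :=
  [set A | continuous A /\
    forall eps : R, 0 < eps -> exists2 delta : R, 0 < delta &
      forall (n : nat) (x y : Omega R), (0 < n)%N -> Bowen_ball x n delta y ->
        `|Birkhoff_sum A n x - Birkhoff_sum A n y| < eps].

(* The pair [(y, x)] stands for (y|x) = (..., y_2, y_1 | x_1, x_2, ...). *)
Definition OmegaHat (R : realType) : Type := (Omega R * Omega R)%type.

(* The point (y_n, ..., y_1, x_1, x_2, ...). *)
Definition past_prefix (R : realType) (y : Omega R) (n : nat) (x : Omega R) :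
    Omega R :=
  prepend (rev (mkseq y n)) x.

(* [series] sums from index 0, so the term of index n is the one for n+1. *)
Definition involution_series (R : realType) (A : Omega R -> R)
    (x' : Omega R) (p : OmegaHat R) : R^nat :=
  series (fun n => A (past_prefix p.1 n.+1 p.2) - A (past_prefix p.1 n.+1 x')).

Definition involution_kernel_exists (R : realType) (A : Omega R -> R)
    (x' : Omega R) : Prop :=
  forall p : OmegaHat R, cvgn (involution_series A x' p).

(* Main.v *)
(** The value of [A] at a point is determined by the first coordinate and by the
    prefix up to the first [k >= 2] where the letter at position 1 changes.
    Hence the involution series at a past that is not constant has finitely many
    nonzero terms, and the kernel exists if and only if, for both letters [e],
    the series of [A(e^n z) - A(e^oo)] converges. If so, then Birkhoff sums of
    two points [x] and [y] that agree up to position [n + M] can only differ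
    along the last constant block of the common prefix, where they are
    differences of tails of that series, and at the letter just before the
    block, where continuity applies. Conversely, comparing the Birkhoff sums of
    [e^oo] and [e^N z] yields the Cauchy criterion. *)

Require Import Defs.
From mathcomp Require Import all_boot all_order all_algebra.
From mathcomp Require Import classical_sets reals topology normedtype sequences.
From mathcomp Require Import boolp functions interval_inference zify lra.

Set Implicit Arguments.
Unset Strict Implicit.
Unset Printing Implicit Defensive.

Import Order.TTheory GRing.Theory Num.Theory.
Import numFieldNormedType.Exports.

Local Open Scope classical_set_scope.
Local Open Scope ring_scope.

(** * Tails of series, reindexing of sums, constant blocks *)

Lemma cvg_series_tailP (R : realType) (u : R^nat) :
  cvgn (series u) <-> forall eps : R, 0 < eps -> exists M, forall m n,
    (M <= m <= n)%N -> `|\sum_(m <= k < n) u k| < eps.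
Proof.
split=> [cu eps e0|cu].
  have /cauchy_seriesP/(_ _ e0)[[P Q] /= [[M _ MP] [K _ KQ]] PQ] :
    cauchy (series u @ \oo) by exact/cauchy_cvgP.
  exists (maxn M K) => m n; rewrite geq_max => /andP[/andP[Mm Km] mn].
  by apply: (PQ (m, n)); split; [exact: MP|apply: KQ; exact: leq_trans mn].
apply/cauchy_cvgP/cauchy_seriesP => e e0; have [M MP] := cu _ e0.
exists ([set n | (M <= n)%N], [set n | (M <= n)%N]).
  by split; exists M.
move=> [m n] [/= Mm Mn]; have [mn|nm] := leqP m n; first by apply: MP; lia.
by rewrite big_geq ?normr0 // ltnW.
Qed.

(** Inside a block that ends at [K], each shift shortens what remains of the block, so a Birkhoff
    sum runs backwards through the terms of a series. *)
Lemma big_nat_subn_rev (V : nmodType) (u : nat -> V) (K s n : nat) :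
  (s <= n <= K)%N ->
  \sum_(s <= j < n) u (K - j.+1)%N = \sum_(K - n <= k < K - s) u k.
Proof.
elim: n => [|n IH] snK.
  by rewrite !big_geq //; lia.
have [->|sn] : s = n.+1 \/ (s <= n)%N by lia.
  by rewrite !big_geq.
rewrite big_nat_recr // IH; last by lia.
rewrite [RHS]big_ltn; last by lia.
by rewrite subnSK 1?addrC //; lia.
Qed.

Lemma last_constant_block (x : nat -> bool) (N : nat) :
  exists s c, [/\ (s <= N)%N, forall i, (s <= i < N.+1)%N -> x i = c &
    (0 < s)%N -> x s.-1 = ~~ c].
Proof.
elim: N => [|N [s [c [sN xc xs]]]].
  by exists 0%N, (x 0%N); split=> // -[].
have [xN|xN] := eqVneq (x N.+1) c.
  exists s, c; split=> [|i iN|//]; first by lia.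
  by have [->//|iN'] := eqVneq i N.+1; apply: xc; lia.
exists N.+1, (~~ c); split=> // [i iN|_].
  by rewrite (_ : i = N.+1); [case: (x N.+1) c xN {xc xs} => -[]|lia].
by rewrite negbK; apply: xc; lia.
Qed.

(** * The metric in terms of common prefixes *)

Lemma half_pow_lt (R : realType) (eps : R) :
  0 < eps -> exists k, 2^-1 ^+ k < eps.
Proof.
move=> e0; have [k _ /(_ k (leqnn k)) /=] :=
  near_infty_natSinv_expn_lt (PosNum e0).
by rewrite div1r -exprVn; exists k.
Qed.

Lemma Omega_dist_le (R : realType) (x y : Omega R) (k : nat) :
  (forall i, (i < k)%N -> x i = y i) -> Omega_dist x y <= 2^-1 ^+ k.
Proof.
move=> xy; rewrite /Omega_dist; case: pselect => [xy'|_]; last first.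
  by rewrite exprn_ge0 // invr_ge0.
case: ex_minnP => m xym _; rewrite ler_wiXn2l ?invr_ge0 ?invf_le1 ?ler1n //.
by apply: ltnW; rewrite ltnS leqNgt; apply: contra xym => /xy ->.
Qed.

Lemma Omega_dist_lt_eq (R : realType) (x y : Omega R) (k i : nat) :
  Omega_dist x y < 2^-1 ^+ k -> (i < k)%N -> x i = y i.
Proof.
move=> xyk ik; apply/eqP; apply: contraTT xyk => /Omega_dist_ge xyi.
rewrite -leNgt; apply: le_trans xyi.
by rewrite ler_wiXn2l ?invr_ge0 ?invf_le1 ?ler1n.
Qed.

Lemma continuous_prefix (R : realType) (A : Omega R -> R) (x : Omega R)
    (eps : R) :
  continuous A -> 0 < eps ->
  exists k, forall y : Omega R, (forall i, (i < k)%N -> x i = y i) ->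
    `|A x - A y| < eps.
Proof.
move=> cA e0; have /cvgrPdist_lt/(_ _ e0)/nbhs_ballP[d /= d0 xd] := cA x.
have [k kd] := half_pow_lt d0.
exists k => y xy; apply: xd; rewrite ballEmdist /=.
exact: le_lt_trans (Omega_dist_le xy) kd.
Qed.

(** * Locality of functions in the Walters family *)

Lemma iter_shiftE (R : realType) (x : Omega R) (j i : nat) :
  iter j (@Omega_shift R) x i = x (j + i)%N.
Proof. by elim: j i => //= j IH i; rewrite /Omega_shift IH addnS. Qed.

Definition constant_word (R : realType) (e : bool) : Omega R := fun=> e.

Lemma past_prefixE (R : realType) (y x : Omega R) (n i : nat) :
  past_prefix y n x i = if (i < n)%N then y (n - i.+1)%N else x (i - n)%N.
Proof.
rewrite /past_prefix /prepend size_rev size_mkseq; case: ifP => // ilt.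
by rewrite nth_rev size_mkseq // nth_mkseq //; lia.
Qed.

Lemma prepend_mkseq (R : realType) (x : Omega R) (k : nat) :
  x = prepend (mkseq x k) (fun i => x (i + k)%N).
Proof.
apply/funext => i; rewrite /prepend size_mkseq; case: ltnP => ik.
  by rewrite nth_mkseq.
by rewrite subnK.
Qed.

(** The least [m > 1] with [x m != x 1] is at most [k], so [x] and [y] share their first [m + 1]
    letters. This word has one of the four shapes of the family, on whose cylinder [A] is
    constant. *)
Lemma Walters_family_local (R : realType) (A : Omega R -> R) (x y : Omega R)
    (k : nat) :
  Walters_family A -> (1 < k)%N -> (forall i, (i <= k)%N -> x i = y i) ->
  x k != x 1%N -> A x = A y.
Proof.
move=> [_ [a [b [c [d [_ HA]]]]]] k1 xy xk.
have : exists j, (1 < j)%N && (x j != x 1%N) by exists k; rewrite k1.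
case/ex_minnP => m /andP[m1 xm] mmin.
have mk : (m <= k)%N by apply: mmin; rewrite k1.
(* With [m = n + 2], the run that starts at position 1 has [n + 1] letters. *)
case: m m1 xm mmin mk => [//|[//|n]] _ xm mmin mk.
have wx : mkseq x n.+3 = x 0%N :: nseq n.+1 (x 1%N) ++ [:: ~~ x 1%N].
  apply: (@eq_from_nth _ false) => [|i].
    by rewrite /= size_map size_iota size_cat size_nseq addn1.
  rewrite size_mkseq => ilt; rewrite nth_mkseq //.
  case: i ilt => [//|i] ilt.
  rewrite -[nth _ _ _]/(nth false (nseq n.+1 (x 1%N) ++ [:: ~~ x 1%N]) i).
  rewrite nth_cat size_nseq.
  case: ltnP => ilt'.
    rewrite nth_nseq ilt'; have [->//|i0] := eqVneq i 0%N.
    by apply/eqP; apply/negPn/negP => xi; have := mmin i.+1; rewrite xi; lia.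
  rewrite (_ : i = n.+1); last by lia.
  by rewrite subnn /=; case: (x n.+2) (x 1%N) xm => -[].
have wy : mkseq x n.+3 = mkseq y n.+3.
  apply/eq_in_map => i; rewrite mem_iota => ilt; apply: xy; lia.
rewrite (prepend_mkseq x n.+3) (prepend_mkseq y n.+3) -wy wx.
set zx := (fun i => x _); set zy := (fun i => y _).
have [// a1 b1 c1 d1] := HA n.+1 zx isT.
have [// a2 b2 c2 d2] := HA n.+1 zy isT.
case: (x 0%N) (x 1%N) => -[].
- exact: etrans c1 (esym c2).
- exact: etrans d1 (esym d2).
- exact: etrans b1 (esym b2).
- exact: etrans a1 (esym a2).
Qed.

(** * Reduction of the kernel to constant pasts *)

Definition letter_term (R : realType) (A : Omega R -> R) (e : bool)
    (z : Omega R) : R^nat :=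
  fun n => A (past_prefix (constant_word R e) n.+1 z) - A (constant_word R e).

Lemma past_prefix_constant_word (R : realType) (e : bool) (n : nat) :
  past_prefix (constant_word R e) n (constant_word R e) = constant_word R e.
Proof. by apply/funext => i; rewrite past_prefixE; case: ifP. Qed.

(** At the past [e^oo], subtracting the kernel series at [e^oo] from the one at [z] cancels the base
    point [x']; subtracting the letter series of [x'] from that of [x] restores it. *)
Lemma kernel_exists_letterP (R : realType) (A : Omega R -> R) (x' : Omega R) :
  Walters_family A ->
  involution_kernel_exists A x' <->
  forall e z, cvgn (series (letter_term A e z)).
Proof.
move=> hA; split=> [ker e z|cvA [y x]].
  have := is_cvg_seriesB (ker (constant_word R e, z))
    (ker (constant_word R e, constant_word R e)).
  congr (cvgn (series _)); apply/funext => n;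
    by rewrite /letter_term !fctE /= past_prefix_constant_word; lra.
have [[m ym]|yc] := pselect (exists m, y m != y 0%N).
  apply/cvg_series_tailP => eps e0; exists m.+1 => i j ij.
  rewrite big_nat_cond big1 ?normr0 // => n /andP[nij _] /=.
  apply/eqP; rewrite subr_eq0; apply/eqP.
  (* In the point with [n + 1] past letters, position 1 carries [y n.-1], position [n - m] carries
     [y m] and position [n] carries [y 0]. As [y m] and [y 0] differ, one of them differs from
     position 1, and locality applies. *)
  have [yn|yn] := eqVneq (y n.-1) (y 0%N).
    have m0 : (0 < m)%N by case: m ym {ij} => //; rewrite eqxx.
    have mn : m <> n.-1 by move=> mn; rewrite mn yn eqxx in ym.
    apply: (@Walters_family_local _ _ _ _ (n - m)%N hA); first by lia.
      by move=> l lm; rewrite !past_prefixE !ifT //; lia.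
    rewrite !past_prefixE !ifT; [|lia|lia].
    rewrite (_ : (n.+1 - (n - m).+1)%N = m); last by lia.
    by rewrite (_ : (n.+1 - 2)%N = n.-1) ?yn //; lia.
  apply: (@Walters_family_local _ _ _ _ n hA).
  - by case: n nij yn => [|[|n]] //; rewrite ?eqxx //; lia.
  - by move=> l lm; rewrite !past_prefixE !ifT //; lia.
  rewrite !past_prefixE !ifT; [|lia|lia].
  by rewrite subnn (_ : (n.+1 - 2)%N = n.-1) 1?eq_sym //; lia.
have -> : y = constant_word R (y 0%N).
  by apply/funext => i; apply/eqP; apply/negPn/negP => yi; apply: yc; exists i.
have := is_cvg_seriesB (cvA (y 0%N) x) (cvA (y 0%N) x').
congr (cvgn (series _)); apply/funext => n;
  by rewrite /letter_term !fctE /=; lra.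
Qed.

(** * Convergence of the letter series and Walters regularity *)

Lemma regular_cvg_letter (R : realType) (A : Omega R -> R) (e : bool)
    (z : Omega R) :
  Walters_regular A -> cvgn (series (letter_term A e z)).
Proof.
move=> [_ regA]; apply/cvg_series_tailP => eps e0.
have [d d0 dA] := regA _ e0; have [M Md] := half_pow_lt d0.
exists M => m p /andP[Mm]; rewrite leq_eqVlt => /predU1P[<-|mp].
  by rewrite big_geq ?normr0.
set x := past_prefix (constant_word R e) p z; set y := constant_word R e.
have xj j : (j < p)%N -> iter j (@Omega_shift R) x = past_prefix y (p - j) z.
  move=> jp; apply/funext => i; rewrite iter_shiftE /x !past_prefixE.
  by rewrite ltn_subRL; case: ifP => // _; congr (z _); lia.
have yj j : iter j (@Omega_shift R) y = y.
  by apply/funext => i; rewrite iter_shiftE.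
(* During the first [p - m] steps more than [m >= M] letters [e] remain in front of [z], so [y]
   stays in the Bowen ball of [x]. *)
have := dA (p - m)%N x y; rewrite subn_gt0 => /(_ mp).
rewrite /Birkhoff_sum -sumrB => H.
rewrite -[X in \sum_(X <= k < _) _](subKn (ltnW mp)).
rewrite -[X in \sum_(_ <= k < X) _]subn0 -big_nat_subn_rev; last by lia.
rewrite (@eq_big_nat _ _ _ _ _ _ (fun j => A (iter j (@Omega_shift R) x) -
    A (iter j (@Omega_shift R) y))) => [|j jp]; last first.
  by rewrite yj xj /letter_term ?subnSK //; lia.
apply: H => j jpm; rewrite xj; last by lia.
rewrite yj; apply: le_lt_trans Md; apply: Omega_dist_le => i iM.
by rewrite past_prefixE ifT //; lia.
Qed.

(** If the block never ends, all terms vanish. If it ends at [K >= n + M], locality replaces what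
    follows by [~~ e] forever, and the sum becomes the slice of the letter series from [K - n >= M]
    to [K - s]. *)
Lemma block_sum_lt (R : realType) (A : Omega R -> R) (e : bool) (eps : R)
    (M s n : nat) (w : Omega R) :
  Walters_family A -> 0 < eps -> (0 < M)%N ->
  (forall m p, (M <= m <= p)%N ->
    `|\sum_(m <= k < p) letter_term A e (constant_word R (~~ e)) k| < eps) ->
  (s <= n)%N -> (forall i, (s <= i < n + M)%N -> w i = e) ->
  `|\sum_(s <= j < n)
     (A (iter j (@Omega_shift R) w) - A (constant_word R e))| < eps.
Proof.
move=> hA e0 M0 tail sn we.
have [|wc] := pselect (exists i, (s <= i)%N && (w i != e)); last first.
  rewrite big_nat_cond big1 ?normr0 // => j /andP[/andP[sj _] _].
  suff -> : iter j (@Omega_shift R) w = constant_word R e by rewrite subrr.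
  apply/funext => i; rewrite iter_shiftE; apply/eqP/negPn/negP => wi.
  by apply: wc; exists (j + i)%N; rewrite wi andbT; lia.
case/ex_minnP => K /andP[sK wK] Kmin.
have KM : (n + M <= K)%N.
  by rewrite leqNgt; apply: contra wK => Kn; rewrite we ?sK.
have wE i : (s <= i < K)%N -> w i = e.
  move=> /andP[si iK]; apply/eqP/negPn/negP => wi.
  by have := Kmin i; rewrite si wi; lia.
suff -> : \sum_(s <= j < n) (A (iter j (@Omega_shift R) w) -
    A (constant_word R e)) =
    \sum_(s <= j < n) letter_term A e (constant_word R (~~ e)) (K - j.+1)%N.
  by rewrite big_nat_subn_rev; [apply: tail; lia|lia].
apply: eq_big_nat => j sjn; rewrite /letter_term; congr (_ - _).
(* Locality needs [K - j > 1], which follows from [j < n] and [0 < M]. *)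
apply: (@Walters_family_local _ _ _ _ (K - j)%N hA); first by lia.
  move=> i iK; rewrite iter_shiftE past_prefixE; case: ltnP => iK'.
    by rewrite wE //; lia.
  rewrite (_ : (j + i)%N = K); last by lia.
  by rewrite /constant_word; case: (w K) e wK {tail we Kmin wE} => -[].
rewrite !iter_shiftE (_ : (j + (K - j))%N = K); last by lia.
by rewrite (wE (j + 1)%N) //; lia.
Qed.

Lemma cvg_letter_regular (R : realType) (A : Omega R -> R) :
  Walters_family A -> (forall e z, cvgn (series (letter_term A e z))) ->
  Walters_regular A.
Proof.
move=> hA cvA; have [cA _] := hA; split=> // eps e0.
(* Two quarters serve the letter before the last block and two the block itself, one each for [x]
   and [y]. *)
have e4 : 0 < eps / 4 by lra.
have tailE e : exists M, forall m p, (M <= m <= p)%N ->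
    `|\sum_(m <= k < p) letter_term A e (constant_word R (~~ e)) k| < eps / 4.
  by move/cvg_series_tailP: (cvA e (constant_word R (~~ e))); apply.
pose pt e : Omega R := fun i => if i is 0%N then ~~ e else e.
have contE e : exists M, forall y : Omega R,
    (forall i, (i < M)%N -> pt e i = y i) -> `|A (pt e) - A y| < eps / 4.
  exact: continuous_prefix.
have [M [M0 tail cont]] : exists M, [/\ (0 < M)%N,
    forall e m p, (M <= m <= p)%N ->
    `|\sum_(m <= k < p) letter_term A e (constant_word R (~~ e)) k| < eps / 4 &
    forall e (y : Omega R),
    (forall i, (i < M)%N -> pt e i = y i) -> `|A (pt e) - A y| < eps / 4].
  have [M1 H1] := tailE true; have [M2 H2] := tailE false.
  have [M3 H3] := contE true; have [M4 H4] := contE false.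
  exists (M1 + M2 + M3 + M4).+1; split=> // -[].
  - by move=> m p mp; apply: H1; lia.
  - by move=> m p mp; apply: H2; lia.
  - by move=> y py; apply: H3 => i iM; apply: py; lia.
  - by move=> y py; apply: H4 => i iM; apply: py; lia.
(* This radius gives agreement at positions [j] to [j + M] for every [j < n], hence at all positions
   below [n + M]. *)
exists (2^-1 ^+ M.+1) => [|n x y n0 xyB]; first by rewrite exprn_gt0 // invr_gt0.
have xy i : (i < n + M)%N -> x i = y i.
  move=> inM; have [iin|ni] := ltnP i n.
    have /Omega_dist_lt_eq/(_ (ltn0Sn M)) := xyB _ iin.
    by rewrite !iter_shiftE addn0.
  have jn : (n.-1 < n)%N by lia.
  have /Omega_dist_lt_eq : mdist (iter n.-1 (@Omega_shift R) x)
    (iter n.-1 (@Omega_shift R) y) < 2^-1 ^+ M.+1 by exact: xyB.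
  move=> /(_ (i - n.-1)%N); rewrite !iter_shiftE.
  by rewrite (_ : (n.-1 + (i - n.-1))%N = i); [apply; lia|lia].
have [s [e []]] := last_constant_block x (n + M).-1.
rewrite prednK; last by lia.
move=> sN xe xs.
rewrite /Birkhoff_sum -sumrB.
pose D j := A (iter j (@Omega_shift R) x) - A (iter j (@Omega_shift R) y).
rewrite -/(\sum_(0 <= j < n) D j).
(* The letters at [s - 1] and [s] differ, so one of them is a change from the letter at [j + 1]
   inside the common prefix. *)
have D0 j : (j < n)%N -> (j.+1 < s)%N -> D j = 0.
  move=> jn js; apply/eqP; rewrite subr_eq0; apply/eqP.
  have xs1 : x s.-1 = ~~ e by apply: xs; lia.
  have xs2 : x s = e by apply: xe; lia.
  have [xj|xj] := eqVneq (x j.+1) e.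
    have sj : s.-1 <> j.+1 by move=> sj; move: xs1; rewrite sj xj; case: (e).
    apply: (@Walters_family_local _ _ _ _ (s.-1 - j)%N hA); first by lia.
      by move=> i ij; rewrite !iter_shiftE; apply: xy; lia.
    rewrite !iter_shiftE (_ : (j + (s.-1 - j))%N = s.-1); last by lia.
    by rewrite addn1 xj xs1; case: (e).
  apply: (@Walters_family_local _ _ _ _ (s - j)%N hA); first by lia.
    by move=> i ij; rewrite !iter_shiftE; apply: xy; lia.
  rewrite !iter_shiftE (_ : (j + (s - j))%N = s); last by lia.
  by rewrite addn1 xs2 eq_sym.
have [ns|sn] := ltnP n s.
  rewrite big_nat_cond big1 ?normr0 // => j /andP[jn _]; apply: D0; lia.
rewrite (big_cat_nat (n := s)) //=.
(* Only [j = s - 1] can contribute. There both shifted points share their first [M] letters with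
   [pt e], and continuity at [pt e] applies. *)
have head : `|\sum_(0 <= j < s) D j| < eps / 4 + eps / 4.
  have [s0|s0] := posnP s; first by rewrite s0 big_geq // normr0; lra.
  rewrite -(prednK s0) big_nat_recr //= big_nat_cond big1 => [|j jn]; last first.
    by apply: D0; lia.
  have near (w : Omega R) : (forall i, (i < n + M)%N -> w i = x i) ->
      `|A (pt e) - A (iter s.-1 (@Omega_shift R) w)| < eps / 4.
    move=> wx; apply: cont => -[|i] iM; rewrite iter_shiftE wx //=.
    - by rewrite addn0 xs.
    - by lia.
    - by rewrite xe //; lia.
    - by lia.
  have ny : `|A (pt e) - A (iter s.-1 (@Omega_shift R) y)| < eps / 4.
    by apply: near => i iM; rewrite xy.
  rewrite add0r; apply: le_lt_trans (ler_distD (A (pt e)) _ _) _.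
  by rewrite distrC ltrD // near.
(* On the block, both orbits are compared with the fixed point [e^oo]. *)
suff : `|\sum_(s <= j < n) D j| < eps / 4 + eps / 4.
  by move=> tl; have := ler_normD (\sum_(0 <= j < s) D j) (\sum_(s <= j < n) D j);
     lra.
have Bx : `|\sum_(s <= j < n)
     (A (iter j (@Omega_shift R) x) - A (constant_word R e))| < eps / 4.
  exact: (block_sum_lt hA e4 M0 (tail e) sn xe).
have By : `|\sum_(s <= j < n)
     (A (iter j (@Omega_shift R) y) - A (constant_word R e))| < eps / 4.
  apply: (block_sum_lt hA e4 M0 (tail e) sn) => i iM.
  by rewrite -xy ?xe //; lia.
apply: le_lt_trans (ltrD Bx By).
apply: le_trans (ler_normB _ _); rewrite -sumrB le_eqVlt; apply/orP; left.
apply/eqP; congr `|_|; apply: eq_bigr => j _; rewrite /D; lra.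
Qed.

Theorem theorem3p1 (R : realType) (A : Omega R -> R) (x' : Omega R)
    (hA : Walters_family A) :
  involution_kernel_exists A x' <-> Walters_regular A.
Proof.
apply: (iff_trans (kernel_exists_letterP x' hA)); split.
  exact: cvg_letter_regular.
by move=> regA e z; exact: regular_cvg_letter.
Qed.
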